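(* Let $A\in\mathbb{R}^{D\times D}$ be real symmetric, $\hat A_1,\hat A_2,\dots$ mutually independent random $D\times D$ matrices with $\mathbb{E}[\hat A_j]=A$, and $\hat T_0=I$, $\hat T_1=\hat A_1$, $\hat T_k=2\hat A_k\hat T_{k-1}-\hat T_{k-2}$ ($k\ge2$). Suppose $4\,\mathbb{E}[\|\hat A_k\|^2]+2\,\mathbb{E}[\|\hat A_k\|]+1\le\alpha$ for all $k\ge1$. Fix $\lambda'\in(-1,1)$ and $\kappa>0$, and draw $k\sim q(\lambda',\kappa)$ independently of $(\hat A_j)_j$. Then $$\mathbb{E}\left[\left\|\frac{\gamma_k(\lambda',\kappa)}{q_k(\lambda',\kappa)}\hat T_k\right\|_F^2\right]\le\frac{D\,e^{\kappa}}{\pi^2I_0(\kappa)}\left(1+\frac{2e^{\kappa}}{I_0(\kappa)}\Big(e^{\alpha\kappa/2}-1\Big)\right).$$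
   Context: $I_\eta(\kappa)$ is the modified Bessel function of the first kind; $\|\cdot\|$ is the spectral norm and $\|\cdot\|_F$ the Frobenius norm. The von Mises kernel Chebyshev coefficients are $\gamma_0(\lambda',\kappa)=1/\pi$ and $\gamma_k(\lambda',\kappa)=\frac{2}{\pi}\frac{I_k(\kappa)}{I_0(\kappa)}\cos(k\arccos\lambda')$ for $k\ge1$. The proposal distribution $q(\lambda',\kappa)$ on $\mathbb{N}_0$ is $q_0(\lambda',\kappa)=1/\mathcal{Z}(\lambda',\kappa)$ and $q_k(\lambda',\kappa)=\frac{2}{\mathcal{Z}(\lambda',\kappa)}\frac{I_k(\kappa)}{I_0(\kappa)}|\cos(k\arccos\lambda')|$ for $k\ge1$, where $\mathcal{Z}(\lambda',\kappa)=1+\frac{2}{I_0(\kappa)}\sum_{k\ge1}I_k(\kappa)|\cos(k\arccos\lambda')|$. Indices $k$ with $q_k=0$ (equivalently $\gamma_k=0$) are never drawn. *)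

(* Defs.v *)
From HB Require Import structures.
From mathcomp Require Import all_boot all_order all_algebra.
From mathcomp Require Import all_classical all_reals all_analysis.
Set Implicit Arguments. Unset Strict Implicit. Unset Printing Implicit Defensive.
Import Order.TTheory GRing.Theory Num.Theory.
Import numFieldNormedType.Exports.
Local Open Scope classical_set_scope.
Local Open Scope ring_scope.

Section Defs.
Variable R : realType.

Definition besselI (eta : nat) (x : R) : R :=
  limn (series (fun m : nat =>
    (x / 2) ^+ (2 * m + eta) / ((m`!)%:R * ((m + eta)`!)%:R))).

(* Chebyshev coefficients of the von Mises kernel *)
Definition gammaVM (lam kappa : R) (k : nat) : R :=
  if k == 0%N then pi^-1
  else 2 / pi * (besselI k kappa / besselI 0 kappa) * cos (k%:R * acos lam).

Definition ZVM (lam kappa : R) : R :=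
  1 + 2 / besselI 0 kappa *
      limn (series (fun k : nat =>
        besselI k.+1 kappa * `|cos (k.+1%:R * acos lam)|)).

Definition qVM (lam kappa : R) (k : nat) : R :=
  if k == 0%N then (ZVM lam kappa)^-1
  else 2 / ZVM lam kappa * (besselI k kappa / besselI 0 kappa)
       * `|cos (k%:R * acos lam)|.

Definition vnorm (D : nat) (v : 'cV[R]_D) : R :=
  Num.sqrt (\sum_(i < D) v i 0 ^+ 2).

Definition specnorm (D : nat) (M : 'M[R]_D) : R :=
  sup [set vnorm (M *m v) | v in [set v : 'cV[R]_D | vnorm v <= 1]].

Definition frobnorm (D : nat) (M : 'M[R]_D) : R :=
  Num.sqrt (\sum_(i < D) \sum_(j < D) M i j ^+ 2).

(* random Chebyshev recursion: returns (T_k, T_{k+1}) *)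
Fixpoint chebT_pair (D : nat) (Ah : nat -> 'M[R]_D) (k : nat)
  : 'M[R]_D * 'M[R]_D :=
  match k with
  | 0%N => (1%:M, Ah 1%N)
  | k'.+1 => let: (a, b) := chebT_pair Ah k' in
             (b, 2%:R *: (Ah k'.+2 *m b) - a)
  end.
Definition chebT (D : nat) (Ah : nat -> 'M[R]_D) (k : nat) : 'M[R]_D :=
  (chebT_pair Ah k).1.

End Defs.

Section Prob.
Context {d : measure_display} {T : measurableType d} {R : realType}.

Definition sigma_mx (D : nat) (X : T -> 'M[R]_D) : set (set T) :=
  <<s [set E | exists (i j : 'I_D) (B : set R),
          measurable B /\ E = (fun x => X x i j) @^-1` B] >>.

Definition sigma_nat (K : T -> nat) : set (set T) :=
  [set K @^-1` B | B in [set: set nat]].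

Definition mutually_independent {I : eqType} (P : probability T R)
  (F : I -> set (set T)) : Prop :=
  forall (J : seq I) (E : I -> set T), uniq J ->
    (forall i, i \in J -> F i (E i)) ->
    P (\big[setI/setT]_(i <- J) E i) = (\prod_(i <- J) P (E i))%E.

End Prob.

(* Main.v *)
Require Import Defs.
From HB Require Import structures.
From mathcomp Require Import all_boot all_order all_algebra.
From mathcomp Require Import all_classical all_reals all_analysis.
From mathcomp Require Import measurable_realfun lra ring.
Import Order.TTheory GRing.Theory Num.Theory.
Import numFieldNormedType.Exports.
Local Open Scope classical_set_scope.
Local Open Scope ring_scope.

(** Write [a_k] for the spectral norm of [Ah_k]. Young's inequality applied to
    the Chebyshev recursion gives the pathwise bound
    [|T_k|_F^2 <= (4 a_k^2 + 2 a_k) |T_(k-1)|_F^2 + (2 a_k + 1) |T_(k-2)|_F^2],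
    whose scalar majorant [u_k] is built by multiplying and adding functions of
    the [a_j]. Independence lets the expectation pass through the recursion
    (one factor at a time, also on the event [K = k]), so that
    [E u_k <= D alpha^k]. With [x = kappa / 2], the bounds
    [I_k <= x^k / k! * I_0] and [I_0 + 2 sum_(k >= 1) I_k <= e^kappa], the latter
    also controlling the normalization [Z], then sum the importance weights. *)

(** * Integrals of independent factors *)

Section product_integral.
Local Open Scope ereal_scope.
Context {d : measure_display} {T : measurableType d} {R : realType}.
Variable mu : {measure set T -> \bar R}.
Import HBNNSimple.

(* If [h dmu] and [c . mu] push forward to the same measure under [g], then
   [h g] integrates like [c . g]. *)
Lemma ge0_integralM_preimage (D : set T) (c : R) (h g : T -> R) :
  measurable D -> (0 <= c)%R ->
  measurable_fun setT h -> (forall x, (0 <= h x)%R) ->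
  measurable_fun setT g -> (forall x, (0 <= g x)%R) ->
  (forall B, measurable B ->
    \int[mu]_(x in D `&` g @^-1` B) (h x)%:E = c%:E * mu (g @^-1` B)) ->
  \int[mu]_(x in D) (h x * g x)%:E = c%:E * \int[mu]_x (g x)%:E.
Proof.
move=> mD c0 mh h0 mg g0 hgB.
have mhD : measurable_fun D (fun x => (h x)%:E).
  by apply/measurable_EFinP; exact: measurable_funTS.
(* Simple functions increase to the identity on the half-line; composed with [g] they approximate
   [g] while staying functions of [g]. *)
pose D0 : set R := [set y | 0 <= y]%R.
have mD0 : measurable D0.
  have -> : D0 = `[0%R, +oo[%classic by apply/seteqP; split => y /=; rewrite in_itv/= andbT.
  exact: measurable_itv.
have mid : measurable_fun D0 (fun y : R => y%:E).
  by apply/measurable_EFinP; exact: measurable_id.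
pose phi := nnsfun_approx mD0 mid.
have phi_cvg x : (phi n (g x))%:E @[n --> \oo] --> (g x)%:E.
  apply: (cvg_nnsfun_approx mD0 mid) => //=; exact: g0.
have phi_nd x : nondecreasing_seq (fun n => phi n (g x)).
  by move=> m n mn; exact/lefP/nd_nnsfun_approx.
have mphig n : measurable_fun setT (fun x => phi n (g x)) by exact: measurableT_comp.
have mpre n y : measurable (g @^-1` (phi n @^-1` [set y])).
  by rewrite -[_ @^-1` _]setTI; exact: mg.
(* For a simple function of [g] the claim is the hypothesis applied to each level set and summed
   over the finite range. *)
have simple n : \int[mu]_(x in D) (h x * phi n (g x))%:E =
    c%:E * \int[mu]_x (phi n (g x))%:E.
  transitivity (\int[mu]_(x in D) (\sum_(y \in range (phi n))
     (y%:E * (h x * \1_(g @^-1` (phi n @^-1` [set y])) x)%:E))).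
    apply: eq_integral => x _; rewrite fimfunE EFinM -fsumEFin//.
    rewrite ge0_mule_fsumr; last by move=> r; rewrite EFinM nnfun_muleindic_ge0.
    by apply: eq_fsbigr => y _; rewrite !EFinM muleCA.
  have mhi y : measurable_fun D (fun x =>
      (h x * \1_(g @^-1` (phi n @^-1` [set y])) x)%:E).
    apply/measurable_EFinP; apply: measurable_funM; exact: measurable_funTS.
  rewrite ge0_integral_fsum//; last 2 first.
  - by move=> y; apply: measurable_funeM; exact: mhi.
  - move=> y x _; rewrite -EFinM mulrCA EFinM mule_ge0 ?lee_fin//.
    by have := @nnfun_muleindic_ge0 _ _ _ (phi n) y (g x); rewrite lee_fin.
  transitivity (\sum_(y \in range (phi n))
     (y%:E * (c%:E * mu (g @^-1` (phi n @^-1` [set y]))))).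
    apply: eq_fsbigr => y; rewrite inE => -[z _ <-].
    rewrite ge0_integralZl// ?lee_fin//; last first.
      by move=> x _; rewrite lee_fin mulr_ge0.
    congr (_ * _); rewrite -hgB// integral_mkcondr.
    by apply: eq_integral => x _; rewrite epatch_indic /= EFinM.
  transitivity (c%:E * \sum_(y \in range (phi n))
     (y%:E * mu (g @^-1` (phi n @^-1` [set y])))).
    rewrite ge0_mule_fsumr.
      by apply: eq_fsbigr => y _; rewrite muleCA.
    move=> y; have [y0|y0] := leP 0%R y; first by rewrite mule_ge0.
    by rewrite preimage_nnfun0// preimage_set0 measure0 mule0.
  congr (_ * _).
  transitivity (\int[mu]_x (\sum_(y \in range (phi n))
     (y * \1_(g @^-1` (phi n @^-1` [set y])) x)%:E)); last first.
    by apply: eq_integral => x _; rewrite fimfunE -fsumEFin.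
  rewrite ge0_integral_fsum//; last 2 first.
  - by move=> y; apply/measurable_EFinP; apply: measurable_funM.
  - move=> y x _; exact: (@nnfun_muleindic_ge0 _ _ _ (phi n) y (g x)).
  apply: eq_fsbigr => y _.
  rewrite (integralZl_indic _ (fun y => g @^-1` (phi n @^-1` [set y])))//.
    by rewrite integral_indic// setIT.
  by move=> y0; rewrite preimage_nnfun0// preimage_set0.
(* Monotone convergence on both sides carries the identity from the simple approximations to [g]. *)
have <- : limn (fun n => \int[mu]_(x in D) (h x * phi n (g x))%:E) =
    \int[mu]_(x in D) (h x * g x)%:E.
  rewrite -monotone_convergence//.
  - apply: eq_integral => x _; apply/cvg_lim => //.
    rewrite EFinM; under eq_fun do rewrite EFinM.
    by apply: cvgeZl => //; exact: phi_cvg.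
  - move=> n; apply/measurable_EFinP; apply: measurable_funM; exact: measurable_funTS.
  - by move=> n x _; rewrite lee_fin mulr_ge0.
  - by move=> x _ m n mn; rewrite lee_fin ler_wpM2l// phi_nd.
have -> : \int[mu]_x (g x)%:E = limn (fun n => \int[mu]_x (phi n (g x))%:E).
  rewrite -monotone_convergence//.
  - by apply: eq_integral => x _; apply/esym/cvg_lim => //; exact: phi_cvg.
  - by move=> n; apply/measurable_EFinP.
  - by move=> n x _; rewrite lee_fin.
  - by move=> x _ m n mn; rewrite lee_fin phi_nd.
under eq_fun do rewrite simple.
rewrite limeMl//.
apply: ereal_nondecreasing_is_cvgn => m n mn; apply: ge0_le_integral => //.
- by move=> x _; rewrite lee_fin.
- exact/measurable_EFinP.
- exact/measurable_EFinP.
- by move=> x _; rewrite lee_fin phi_nd.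
Qed.

End product_integral.

(** * Modified Bessel functions *)

Section bessel.
Context {R : realType}.
Implicit Types (x y : R) (k m n : nat).

Lemma series_exp_coeff_le_expR x n : 0 <= x -> series (exp_coeff x) n <= expR x.
Proof.
move=> x0; apply: nondecreasing_cvgn_le; last exact: is_cvg_series_exp_coeff.
by apply: nondecreasing_series => i _ _; exact: exp_coeff_ge0.
Qed.

(** Factoring each Bessel summand into two coefficients of exp(kappa / 2) reduces everything to
    tails of one exponential series. *)
Let besselI_term (eta : nat) (kappa : R) (m : nat) : R :=
  exp_coeff (kappa / 2) m * exp_coeff (kappa / 2) (m + eta)%N.

Lemma besselIE eta (kappa : R) :
  besselI eta kappa = limn (series (besselI_term eta kappa)).
Proof.
rewrite /besselI; congr (limn (series _)); apply/funext => m.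
rewrite /besselI_term /exp_coeff /= mulf_div -exprD.
by congr (_ ^+ _ / _); rewrite addnA mul2n addnn.
Qed.

Section nonneg.
Variable kappa : R.
Hypothesis kappa0 : 0 <= kappa.

Let x := kappa / 2.

Let x0 : 0 <= x. Proof. by rewrite /x divr_ge0. Qed.

Let e_ge0 i : 0 <= exp_coeff x i. Proof. exact: exp_coeff_ge0. Qed.

Let tail n := expR x - series (exp_coeff x) n.

Let tailS n : exp_coeff x n = tail n - tail n.+1.
Proof. by rewrite /tail seriesSr; ring. Qed.

Let sum_shift_le_tail m n : \sum_(0 <= k < n) exp_coeff x (m + k.+1)%N <= tail m.+1.
Proof.
rewrite /tail lerBrDl (le_trans _ (series_exp_coeff_le_expR _ (m.+1 + n)%N x0))//.
rewrite /series/= [leRHS](@big_cat_nat _ _ _ m.+1)//= ?leq_addr// lerD2l.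
have := big_addn 0%N (m.+1 + n)%N m.+1 xpredT (exp_coeff x).
rewrite add0n addKn => ->.
by under [leRHS]eq_bigr do rewrite addnS addnC -addnS.
Qed.

Let term_ge0 eta m : 0 <= besselI_term eta kappa m.
Proof. by rewrite mulr_ge0// e_ge0. Qed.

(* With [r_m] the [m]-th tail of the series of [exp x], each summand
   [e_m (e_m + 2 r_(m+1))] telescopes as [r_m ^ 2 - r_(m+1) ^ 2]. *)
Let bessel_partial_sum_le M n :
  series (besselI_term 0%N kappa) M +
  2 * \sum_(0 <= k < n) series (besselI_term k.+1 kappa) M <= expR kappa.
Proof.
have -> : expR kappa = tail 0%N ^+ 2.
  by rewrite /tail /series/= big_geq// subr0 expr2 -expRD -splitr.
apply: (@le_trans _ _ (tail 0%N ^+ 2 - tail M ^+ 2)); last first.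
  by rewrite gerBl sqr_ge0.
rewrite exchange_big/= mulr_sumr /series/= -big_split/=.
elim: M => [|M IH]; first by rewrite big_geq// subrr.
rewrite big_nat_recr//=.
apply: (le_trans (lerD IH (_ : _ <= tail M ^+ 2 - tail M.+1 ^+ 2))); last by lra.
rewrite /besselI_term -/x addn0 -mulr_sumr [2 * _]mulrCA -mulrDr subr_sqr -tailS.
apply: ler_wpM2l => //; have := tailS M; have := sum_shift_le_tail M n; lra.
Qed.

Lemma is_cvg_series_besselI eta : cvgn (series (besselI_term eta kappa)).
Proof.
apply: nondecreasing_is_cvgn.
  by apply: nondecreasing_series => i _ _; exact: term_ge0.
(* Taking [n := eta] in the bound makes the partial sum of order [eta] one of its nonnegative
   terms. *)
exists (expR kappa) => _ [M _ <-].
have s0 k : 0 <= series (besselI_term k kappa) M by apply: sumr_ge0 => i _.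
have := bessel_partial_sum_le M eta; have s00 := s0 0%N.
case: eta => [|eta]; first by rewrite big_geq// mulr0 addr0.
rewrite big_nat_recr//=; set S := \sum_(_ <= _ < _) _.
have : 0 <= S by apply: sumr_ge0 => i _; exact: s0.
have := s0 eta.+1; lra.
Qed.

Lemma besselI_ge0 eta : 0 <= besselI eta kappa.
Proof.
rewrite besselIE limr_ge//; first exact: is_cvg_series_besselI.
by apply: nearW => n; apply: sumr_ge0 => i _.
Qed.

Lemma besselI0_ge1 : 1 <= besselI 0%N kappa.
Proof.
rewrite besselIE.
apply: (@le_trans _ _ (series (besselI_term 0%N kappa) 1%N)); last first.
  apply: nondecreasing_cvgn_le; last exact: is_cvg_series_besselI.
  by apply: nondecreasing_series => i _ _; exact: term_ge0.
by rewrite /series/= big_nat1 /besselI_term /exp_coeff/= !expr0 fact0 divr1 mulr1.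
Qed.

(** One half of the generating function identity at 1, obtained by letting the truncation [M] tend
    to infinity with [n] fixed. *)
Lemma besselI_sum_le_expR n :
  besselI 0%N kappa + 2 * \sum_(0 <= k < n) besselI k.+1 kappa <= expR kappa.
Proof.
have cvS k := is_cvg_series_besselI k.
have cvs : (series (besselI_term 0%N kappa) M +
  2 * \sum_(0 <= k < n) series (besselI_term k.+1 kappa) M) @[M --> \oo] -->
  besselI 0%N kappa + 2 * \sum_(0 <= k < n) besselI k.+1 kappa.
  apply: cvgD; first by rewrite besselIE; exact: cvS.
  apply: cvgM; first exact: cvg_cst.
  by apply: cvg_big => [|k _]; [exact: add_continuous|rewrite besselIE; exact: cvS].
rewrite -(cvg_lim _ cvs)//; apply: limr_le; first by apply/cvg_ex; eexists; exact: cvs.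
by apply: nearW => M; exact: bessel_partial_sum_le.
Qed.

(** Holds term by term, since m! eta! divides (m + eta)! with a positive binomial quotient. *)
Lemma besselI_le eta :
  besselI eta kappa <= exp_coeff (kappa / 2) eta * besselI 0%N kappa.
Proof.
rewrite !besselIE.
have -> : exp_coeff (kappa / 2) eta * limn (series (besselI_term 0%N kappa)) =
    limn (series (exp_coeff (kappa / 2) eta *: besselI_term 0%N kappa)).
  by rewrite lim_seriesZ//; exact: is_cvg_series_besselI.
apply: lim_series_le; first exact: is_cvg_series_besselI.
  by apply: is_cvg_seriesZ; exact: is_cvg_series_besselI.
move=> m; rewrite -[leRHS]/(exp_coeff x eta * besselI_term 0%N kappa m).
rewrite /besselI_term -/x addn0 [leRHS]mulrCA ler_wpM2l//.
rewrite /exp_coeff/= exprD mulf_div [_ ^+ m * _]mulrC ler_wpM2l//.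
  by rewrite mulr_ge0// exprn_ge0.
rewrite lef_pV2 ?posrE ?mulr_gt0 ?ltr0n ?fact_gt0// -natrM ler_nat.
rewrite -(@bin_fact (m + eta)%N m) ?leq_addr// addKn [X in (X <= _)%N]mulnC.
by rewrite leq_pmull// bin_gt0 leq_addr.
Qed.

End nonneg.
End bessel.

(** * Spectral and Frobenius norms *)

Section spectral_frobenius.
Context {R : realType} {D : nat}.
Implicit Types (M N : 'M[R]_D) (v : 'cV[R]_D) (c : R).

Definition sqnorm v : R := \sum_(i < D) v i 0 ^+ 2.
Definition sqfrob M : R := \sum_(i < D) \sum_(j < D) M i j ^+ 2.

Lemma sqnorm_ge0 v : 0 <= sqnorm v.
Proof. by apply: sumr_ge0 => i _; exact: sqr_ge0. Qed.

Lemma sqfrob_ge0 M : 0 <= sqfrob M.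
Proof. by apply: sumr_ge0 => i _; apply: sumr_ge0 => j _; exact: sqr_ge0. Qed.

Lemma vnorm_sqr v : vnorm v ^+ 2 = sqnorm v.
Proof. by rewrite sqr_sqrtr// sqnorm_ge0. Qed.

Lemma frobnorm_sqr M : frobnorm M ^+ 2 = sqfrob M.
Proof. by rewrite sqr_sqrtr// sqfrob_ge0. Qed.

Lemma vnorm_ge0 v : 0 <= vnorm v. Proof. exact: sqrtr_ge0. Qed.

Lemma vnorm0 : vnorm (0 : 'cV[R]_D) = 0.
Proof. by rewrite /vnorm big1 ?sqrtr0// => i _; rewrite mxE expr0n. Qed.

Lemma vnormZ c v : vnorm (c *: v) = `|c| * vnorm v.
Proof.
rewrite /vnorm (eq_bigr (fun i => c ^+ 2 * v i 0 ^+ 2)); last first.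
  by move=> i _; rewrite mxE exprMn.
by rewrite -mulr_sumr sqrtrM ?sqr_ge0// sqrtr_sqr.
Qed.

Lemma vnorm_eq0 v : vnorm v = 0 -> v = 0.
Proof.
move=> v0; apply/matrixP => i j; rewrite ord1 mxE.
have : sqnorm v = 0 by rewrite -vnorm_sqr v0 expr0n.
move/eqP; rewrite psumr_eq0 => [|k _]; last exact: sqr_ge0.
by move=> /allP/(_ i (mem_index_enum _))/=; rewrite sqrf_eq0 => /eqP.
Qed.

Lemma vnorm_le_sqr c v : 0 <= c -> (vnorm v <= c) = (sqnorm v <= c ^+ 2).
Proof. by move=> c0; rewrite -vnorm_sqr ler_pXn2r// nnegrE vnorm_ge0. Qed.

Let unit_image M := [set vnorm (M *m v) | v in [set v : 'cV[R]_D | vnorm v <= 1]].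

Let unit_image_has_sup M : has_sup (unit_image M).
Proof.
split; first by exists (vnorm (M *m 0)), 0 => //=; rewrite vnorm0 ler01.
(* Coordinates of a vector in the unit ball lie in [-1, 1], so the absolute row sums bound the
   entries of its image. *)
exists (Num.sqrt (\sum_(i < D) (\sum_(j < D) `|M i j|) ^+ 2)) => _ [v /= v1 <-].
rewrite ler_sqrt; last by apply: sumr_ge0 => i _; exact: sqr_ge0.
apply: ler_sum => i _; rewrite -[leLHS]real_normK ?num_real// ler_pXn2r ?nnegrE//; last exact: sumr_ge0.
rewrite mxE (le_trans (ler_norm_sum _ _ _))//; apply: ler_sum => j _.
rewrite normrM ler_piMr//.
have : sqnorm v <= 1 by rewrite -(expr1n _ 2) -vnorm_le_sqr.
rewrite /sqnorm (bigD1 j)//= => vj.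
rewrite -[1]gtr0_norm// -ler_sqr ?nnegrE//= !real_normK ?num_real// expr1n.
by apply: le_trans vj; rewrite lerDl sumr_ge0// => k _; exact: sqr_ge0.
Qed.

Lemma specnorm_ge0 M : 0 <= specnorm M.
Proof.
apply: (@le_trans _ _ (vnorm (M *m 0))); first exact: vnorm_ge0.
apply: sup_upper_bound; first exact: unit_image_has_sup.
by exists 0 => //=; rewrite vnorm0 ler01.
Qed.

Lemma vnorm_mulmx_le M v : vnorm (M *m v) <= specnorm M * vnorm v.
Proof.
have := vnorm_ge0 v; rewrite le_eqVlt => /predU1P[/esym v0|v0].
  by rewrite (vnorm_eq0 _ v0) mulmx0 vnorm0 mulr0.
rewrite -ler_pdivrMr//.
have -> : vnorm (M *m v) / vnorm v = vnorm (M *m ((vnorm v)^-1 *: v)).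
  by rewrite -scalemxAr vnormZ gtr0_norm ?invr_gt0// mulrC.
apply: sup_upper_bound; first exact: unit_image_has_sup.
exists ((vnorm v)^-1 *: v) => //=.
by rewrite vnormZ gtr0_norm ?invr_gt0// mulVf// gt_eqF.
Qed.

(** Trades the supremum for inequalities between quadratic forms, free of square roots. *)
Lemma specnorm_leP M c : 0 <= c ->
  specnorm M <= c <-> forall v, sqnorm (M *m v) <= c ^+ 2 * sqnorm v.
Proof.
move=> c0; split=> [Mc v|Mc].
  rewrite -!vnorm_sqr -exprMn ler_pXn2r ?nnegrE ?mulr_ge0 ?vnorm_ge0//.
  by rewrite (le_trans (vnorm_mulmx_le _ _))// ler_wpM2r// vnorm_ge0.
apply: ge_sup; first by case: (unit_image_has_sup M).
move=> _ [v /= v1 <-]; rewrite vnorm_le_sqr// (le_trans (Mc v))//.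
by rewrite ler_piMr ?sqr_ge0// -(expr1n _ 2) -vnorm_le_sqr.
Qed.

(* By homogeneity the integer vectors stand for the rational ones, which are dense. *)
Lemma specnorm_le_intP M c : 0 <= c ->
  specnorm M <= c <-> forall z : 'cV[int]_D,
    sqnorm (M *m map_mx intr z) <= c ^+ 2 * sqnorm (map_mx intr z).
Proof.
move=> c0; split=> [/specnorm_leP Mc z|Mc]; first exact: Mc.
apply/specnorm_leP => // v.
(* Rounding (n + 1) v down and rescaling gives [w n], each of whose coordinates is within 1 / (n +
   1) of that of [v]. *)
pose z n : 'cV[int]_D := \col_i Num.floor (n.+1%:R * v i 0).
pose w n : 'cV[R]_D := n.+1%:R^-1 *: map_mx intr (z n).
have sqnormZ a (u : 'cV[R]_D) : sqnorm (a *: u) = a ^+ 2 * sqnorm u.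
  by rewrite -!vnorm_sqr vnormZ exprMn real_normK ?num_real.
have Mcw n : sqnorm (M *m w n) <= c ^+ 2 * sqnorm (w n).
  by rewrite /w -scalemxAr !sqnormZ mulrCA ler_wpM2l ?sqr_ge0.
have cvg_w i : w n i 0 @[n --> \oo] --> v i 0.
  apply: (@squeeze_cvgr _ _ _ _ (fun n => v i 0 - n.+1%:R^-1) (fun=> v i 0)).
  - apply: nearW => n; rewrite !mxE mulrC ler_pdivrMr ?ltr0n//.
    rewrite ler_pdivlMr ?ltr0n// mulrBl mulVf ?pnatr_eq0// mulrC.
    by rewrite ge_floor// lerBlDr -natr1 -intrD1 ltW// floorD1_gt.
  - rewrite -[X in _ --> X]subr0; apply: cvgB; first exact: cvg_cst.
    exact: cvg_harmonic.
  - exact: cvg_cst.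
have cvg_sqnorm (u : nat -> 'cV[R]_D) (u' : 'cV[R]_D) :
    (forall i, u n i 0 @[n --> \oo] --> u' i 0) ->
    sqnorm (u n) @[n --> \oo] --> sqnorm u'.
  move=> uu'; apply: cvg_big => [|i _]; first exact: add_continuous.
  by rewrite expr2; under eq_fun do rewrite expr2; apply: cvgM.
have cvg_Mw i : (M *m w n) i 0 @[n --> \oo] --> (M *m v) i 0.
  rewrite mxE; under eq_fun do rewrite mxE.
  apply: cvg_big => [|j _]; first exact: add_continuous.
  by apply: cvgM; [exact: cvg_cst|exact: cvg_w].
apply: (ler_cvg_to (cvg_sqnorm _ _ cvg_Mw)
  (cvgM (cvg_cst (c ^+ 2)) (cvg_sqnorm _ _ cvg_w))).
exact: nearW.
Qed.

Lemma sqfrob1 : sqfrob (1%:M : 'M[R]_D) = D%:R.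
Proof.
rewrite /sqfrob (eq_bigr (fun=> 1)) ?sumr_const ?card_ord// => i _.
rewrite (bigD1 i)//= mxE eqxx expr1n big1 ?addr0// => j ji.
by rewrite mxE eq_sym (negbTE ji) expr0n.
Qed.

Lemma sqfrobZ c M : sqfrob (c *: M) = c ^+ 2 * sqfrob M.
Proof.
rewrite /sqfrob mulr_sumr; apply: eq_bigr => i _; rewrite mulr_sumr.
by apply: eq_bigr => j _; rewrite mxE exprMn.
Qed.

(** The squared Frobenius norm is the sum of the squared norms of the columns, and [M] acts on each
    column separately. *)
Lemma sqfrob_mulmx_le M N : sqfrob (M *m N) <= specnorm M ^+ 2 * sqfrob N.
Proof.
have sqfrob_col (L : 'M[R]_D) : sqfrob L = \sum_(j < D) sqnorm (col j L).
  rewrite /sqfrob exchange_big/=; apply: eq_bigr => j _.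
  by apply: eq_bigr => i _; rewrite mxE.
rewrite !sqfrob_col mulr_sumr; apply: ler_sum => j _.
rewrite !colE -mulmxA; apply: (specnorm_leP _ _ _).1 => //; exact: specnorm_ge0.
Qed.

Lemma sqfrob_chebyshev_step M N L (a := specnorm M) :
  sqfrob (2%:R *: (M *m N) - L) <=
  (4 * a ^+ 2 + 2 * a) * sqfrob N + (2 * a + 1) * sqfrob L.
Proof.
have a0 : 0 <= a by exact: specnorm_ge0.
(* The Young weight 2 / a requires a > 0; when a = 0 the product [M *m N] vanishes and only [L]
   remains. *)
have := a0; rewrite le_eqVlt => /predU1P[/esym az|apos].
  have -> : M *m N = 0.
    apply/matrixP => i j; have := vnorm_mulmx_le M (col j N).
    rewrite -/a az mul0r => Mv.
    have : vnorm (M *m col j N) = 0 by apply/eqP; rewrite eq_le Mv vnorm_ge0.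
    by move/vnorm_eq0/colP/(_ i); rewrite colE mulmxA -colE !mxE.
  rewrite az scaler0 sub0r -scaleN1r sqfrobZ.
  by rewrite -signr_odd expr0n !mulr0 addr0 mul0r !add0r.
(* Young's inequality: [- 4 x y <= 2 x ^ 2 / a + 2 a y ^ 2]. *)
apply: (@le_trans _ _ ((4 + 2 / a) * sqfrob (M *m N) + (2 * a + 1) * sqfrob L)).
  rewrite /sqfrob !mulr_sumr -big_split/=; apply: ler_sum => i _.
  rewrite !mulr_sumr -big_split/=; apply: ler_sum => j _.
  rewrite !mxE; set x := \sum_(_ < _) _; set y := L i j.
  rewrite -subr_ge0 (_ : _ - _ = 2 / a * (x + a * y) ^+ 2).
    by rewrite mulr_ge0 ?sqr_ge0// divr_ge0.
  by field; rewrite gt_eqF.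
rewrite lerD2r; apply: le_trans (ler_wpM2l _ (sqfrob_mulmx_le M N)) _.
  by rewrite addr_ge0// divr_ge0.
rewrite mulrA (_ : (4 + 2 / a) * specnorm M ^+ 2 = 4 * a ^+ 2 + 2 * a)//.
by rewrite -/a; field; rewrite gt_eqF.
Qed.

End spectral_frobenius.

(** * Measurability of the spectral norm *)

Section measurability_specnorm.
Context {R : realType} {D : nat}.

(** The supremum runs over uncountably many vectors, but integer vectors suffice, so each superlevel
    set is a countable union. *)
Lemma measurable_specnorm {d : measure_display} {T : measurableType d}
    (X : T -> 'M[R]_D) :
  (forall i j, measurable_fun setT (fun x => X x i j)) ->
  measurable_fun setT (fun x => specnorm (X x)).
Proof.
move=> mX; apply: (measurability (@RGenOInfty.G R)) => [|/= _ [_] [c] -> <-].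
  exact: RGenOInfty.measurableE.
rewrite setTI; have [c0|c0] := ltP c 0.
  rewrite (_ : _ @^-1` _ = setT)//; apply/seteqP; split => x //= _.
  by rewrite in_itv/= andbT (lt_le_trans c0)// specnorm_ge0.
(* The event that [z] witnesses a spectral norm above [c]; the union below enumerates the witnesses
   through [pickle]. *)
pose lt_at (z : 'cV[int]_D) : set T := [set x |
  c ^+ 2 * sqnorm (map_mx intr z) < sqnorm (X x *m map_mx intr z)].
rewrite (_ : _ @^-1` _ =
  \bigcup_n (if unpickle n is Some z then lt_at z else set0)).
  apply: bigcupT_measurable => n; case: unpickle => // z.
  rewrite -[lt_at z]setTI.
  rewrite [X in measurable X](_ : _ = setT `&`
      (fun x => sqnorm (X x *m map_mx intr z)) @^-1`
      `]c ^+ 2 * sqnorm (map_mx intr z : 'cV[R]_D), +oo[%classic); last first.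
    by congr (_ `&` _); apply/seteqP; split => x /=; rewrite in_itv/= andbT.
  suff : measurable_fun setT (fun x => sqnorm (X x *m map_mx intr z)).
    by move=> /(_ measurableT); apply; exact: measurable_itv.
  apply: measurable_sum => i; apply: measurable_funX.
  under eq_fun do rewrite mxE.
  by apply: measurable_sum => j; apply: measurable_funM.
apply/seteqP; split => x /=.
  rewrite in_itv/= andbT => cX; apply: contrapT => nlt.
  suff : specnorm (X x) <= c by rewrite leNgt cX.
  apply: (specnorm_le_intP _ _ _).2 => // z; rewrite leNgt; apply/negP => ltz.
  by apply: nlt; exists (pickle z) => //; rewrite pickleK.
move=> [n _]; case: unpickle => [z|//] ltz.
rewrite in_itv/= andbT ltNge; apply/negP => /(specnorm_le_intP _ _ c0).1/(_ z).
by rewrite leNgt ltz.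
Qed.

Lemma sigma_mx_preimage_specnorm {d : measure_display} {T : measurableType d}
    (X : T -> 'M[R]_D) (phi : R -> R) (B : set R) :
  measurable_fun setT phi -> measurable B ->
  sigma_mx X ((fun x => phi (specnorm (X x))) @^-1` B).
Proof.
move=> mphi mB.
pose G := [set E | exists (i j : 'I_D) (B : set R),
  measurable B /\ E = (fun x => X x i j) @^-1` B].
(* Viewing [X] on the coarser space whose events are generated by its entries turns membership in
   [sigma_mx X] into plain measurability. *)
pose Y : g_sigma_algebraType G -> 'M[R]_D := X.
have mY i j : measurable_fun setT (fun x => Y x i j).
  move=> _ C mC; rewrite setTI; apply: sub_sigma_algebra.
  by exists i, j, C.
have mphiY : measurable_fun setT (fun x => phi (specnorm (Y x))).
  by apply: measurableT_comp => //; exact: measurable_specnorm.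
by have := mphiY measurableT B mB; rewrite setTI.
Qed.

Lemma sigma_mx_measurable {d : measure_display} {T : measurableType d}
    (X : T -> 'M[R]_D) :
  (forall i j, measurable_fun setT (fun x => X x i j)) ->
  sigma_mx X `<=` measurable.
Proof.
move=> mX; apply: smallest_sub; first exact: sigma_algebra_measurable.
by move=> _ [i [j [B [mB ->]]]]; rewrite -[_ @^-1` _]setTI; exact: mX.
Qed.

End measurability_specnorm.

(** * Expectations decoupled from independent events *)

Section decoupling.
Local Open Scope ereal_scope.
Context {d : measure_display} {T : measurableType d} {R : realType}.
Context {I : eqType}.
Variables (P : probability T R) (F : I -> set (set T)).
Hypothesis F_measurable : forall i, F i `<=` measurable.
Hypothesis F_independent : mutually_independent P F.

(* [h] has mean [c] and is independent of the classes [F i] with [i] outside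
   of [S]. *)
Definition decoupled (S : pred I) (h : T -> R) (c : R) : Prop :=
  forall (J : seq I) (E : I -> set T), uniq J ->
    (forall i, i \in J -> ~~ S i /\ F i (E i)) ->
    \int[P]_(x in \big[setI/setT]_(i <- J) E i) (h x)%:E =
    c%:E * P (\big[setI/setT]_(i <- J) E i).

Lemma measurable_bigsetI_family (J : seq I) (E : I -> set T) :
  (forall i, i \in J -> F i (E i)) ->
  measurable (\big[setI/setT]_(i <- J) E i).
Proof.
move=> FE; rewrite big_seq; apply: bigsetI_measurable => i iJ.
exact/F_measurable/FE.
Qed.

Lemma decoupled_cst (S : pred I) (c : R) : decoupled S (fun=> c) c.
Proof.
move=> J E _ FE; rewrite integral_cst//.
by apply: measurable_bigsetI_family => i /FE[].
Qed.

Lemma decoupled_sub {S S' : pred I} {h : T -> R} {c : R} :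
  (forall i, S i -> S' i) -> decoupled S h c -> decoupled S' h c.
Proof.
move=> SS' Sh J E uJ FE; apply: Sh => // i /FE[S'i FEi]; split=> //.
by apply: contra S'i; exact: SS'.
Qed.

Lemma decoupledD {S : pred I} {h h' : T -> R} {c c' : R} :
  (forall x, 0 <= h x)%R -> measurable_fun setT h ->
  (forall x, 0 <= h' x)%R -> measurable_fun setT h' ->
  decoupled S h c -> decoupled S h' c' ->
  decoupled S (fun x => h x + h' x)%R (c + c')%R.
Proof.
move=> h0 mh h'0 mh' Sh Sh' J E uJ FE.
have mE : measurable (\big[setI/setT]_(i <- J) E i).
  by apply: measurable_bigsetI_family => i /FE[].
under eq_integral do rewrite EFinD.
rewrite ge0_integralD//; last 4 first.
- by move=> x _; rewrite lee_fin.
- by apply/measurable_EFinP; exact: measurable_funTS.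
- by move=> x _; rewrite lee_fin.
- by apply/measurable_EFinP; exact: measurable_funTS.
by rewrite Sh// Sh'// EFinD muleDl// fin_num_measure.
Qed.

(** Events of [g] belong to class [i], from which [h] is still decoupled; after the multiplication
    [i] must join the set of used indices. *)
Lemma decoupledM {S : pred I} {i : I} {h g : T -> R} {c c' : R} :
  ~~ S i -> (0 <= c)%R ->
  (forall x, 0 <= h x)%R -> measurable_fun setT h ->
  (forall x, 0 <= g x)%R ->
  (forall B, measurable B -> F i (g @^-1` B)) ->
  \int[P]_x (g x)%:E = c'%:E ->
  decoupled S h c ->
  decoupled (predU1 i S) (fun x => h x * g x)%R (c * c')%R.
Proof.
move=> Si c0 h0 mh g0 Fg Eg Sh J E uJ FE.
have iJ : i \notin J by apply/negP => /FE[]; rewrite /= eqxx.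
have FJ j : j \in J -> ~~ S j /\ F j (E j).
  by move=> /FE[/=]; rewrite negb_or => /andP[].
set D := \big[setI/setT]_(i <- J) E i.
have mD : measurable D by apply: measurable_bigsetI_family => j /FJ[].
have mg : measurable_fun setT g.
  by move=> _ B mB; rewrite setTI; exact: F_measurable (Fg _ mB).
(* Adding the event on [g] to the family gives c P(D and g in B), which independence splits as c
   P(D) P(g in B); hence this constant. *)
rewrite (@ge0_integralM_preimage _ _ _ _ _ (c * fine (P D))%R)//; last 2 first.
- by rewrite mulr_ge0// fine_ge0.
- move=> B mB; pose E' j := if j == i then g @^-1` B else E j.
  have E'J : \big[setI/setT]_(j <- J) E' j = D.
    apply: eq_big_seq => j jJ; rewrite /E'; case: eqP => // ji.
    by rewrite -ji jJ in iJ.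
  have FE' j : j \in i :: J -> ~~ S j /\ F j (E' j).
    rewrite inE /E'; case: eqP => [-> _|_ /=]; last exact: FJ.
    by split => //; exact: Fg.
  have uiJ : uniq (i :: J) by rewrite /= iJ.
  have E'i : E' i = g @^-1` B by rewrite /E' eqxx.
  have := Sh _ E' uiJ FE'; rewrite big_cons E'J E'i setIC => ->.
  have := F_independent _ E' uiJ (fun j jJ => (FE' j jJ).2).
  rewrite !big_cons E'J E'i setIC => ->.
  have FE'J j : j \in J -> F j (E' j).
    by move=> jJ; apply: (FE' j _).2; rewrite inE jJ orbT.
  rewrite -(F_independent _ E' uJ FE'J).
  by rewrite E'J EFinM fineK ?fin_num_measure// -muleA [P D * _]muleC.
rewrite Eg !EFinM fineK ?fin_num_measure//.
by rewrite -!muleA [P D * _]muleC.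
Qed.

End decoupling.

(** * The Chebyshev recursion *)

(** Compares directly the suprema over simple functions that define the integrals. It serves for the
    integrand evaluated at the random index, whose measurability is not established. *)
Lemma ge0_le_integralT {d : measure_display} {T : measurableType d}
    {R : realType} (mu : {measure set T -> \bar R}) (f g : T -> \bar R) :
  (forall x, 0 <= f x)%E -> (forall x, f x <= g x)%E ->
  (\int[mu]_x f x <= \int[mu]_x g x)%E.
Proof.
move=> f0 fg; have g0 x : (0 <= g x)%E by exact: le_trans (fg x).
rewrite !ge0_integralTE//; apply: ge_ereal_sup => _ [h hf <-].
by apply: ereal_sup_ubound; exists h => // x; exact: le_trans (fg x).
Qed.

Section chebyshev_majorant.
Context {R : realType}.
Implicit Types (p r : nat -> R) (c alpha : R) (k : nat).

(** Used both pathwise, with [p] and [r] functions of the spectral norms, and in mean, with their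
    expectations; [c] is the initial value D. *)
Fixpoint cheb_majorant p r c k : R :=
  match k with
  | 0 => c
  | k1.+1 => match k1 with
             | 0 => c * p k
             | k2.+1 => cheb_majorant p r c k1 * p k + cheb_majorant p r c k2 * r k
             end
  end.

Lemma cheb_majorantSS p r c k : cheb_majorant p r c k.+2 =
  cheb_majorant p r c k.+1 * p k.+2 + cheb_majorant p r c k * r k.+2.
Proof. by []. Qed.

Lemma cheb_majorant_ge0 p r c k : 0 <= c ->
  (forall j, (0 < j)%N -> 0 <= p j) -> (forall j, (0 < j)%N -> 0 <= r j) ->
  0 <= cheb_majorant p r c k.
Proof.
move=> c0 p0 r0.
(* The recursion has order two, so the induction carries two consecutive indices. *)
suff : 0 <= cheb_majorant p r c k /\ 0 <= cheb_majorant p r c k.+1 by case.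
elim: k => [|k [IH0 IH1]]; first by split=> //=; rewrite mulr_ge0// p0.
by split=> //; rewrite cheb_majorantSS addr_ge0// mulr_ge0// ?p0// r0.
Qed.

Lemma cheb_majorant_le p r c alpha k : 0 <= c -> 1 <= alpha ->
  (forall j, (0 < j)%N -> 0 <= p j <= alpha - 1) ->
  (forall j, (0 < j)%N -> 0 <= r j <= alpha) ->
  cheb_majorant p r c k <= c * alpha ^+ k.
Proof.
move=> c0 a1 pa ra; have a0 : 0 <= alpha by exact: le_trans a1.
have p0 j : (0 < j)%N -> 0 <= p j by move=> /pa/andP[].
have r0 j : (0 < j)%N -> 0 <= r j by move=> /ra/andP[].
suff : cheb_majorant p r c k <= c * alpha ^+ k /\
  cheb_majorant p r c k.+1 <= c * alpha ^+ k.+1 by case.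
elim: k => [|k [IH0 IH1]].
  split; first by rewrite /= expr0 mulr1.
  by rewrite /= expr1 ler_wpM2l//; have /andP[_] := pa 1%N erefl; lra.
split=> //; rewrite cheb_majorantSS.
(* This splitting is why [p] is bounded by alpha - 1 and [r] by alpha. *)
have -> : c * alpha ^+ k.+2 =
    c * alpha ^+ k.+1 * (alpha - 1) + c * alpha ^+ k * alpha.
  by rewrite !exprS; ring.
apply: lerD; apply: ler_pM; rewrite ?cheb_majorant_ge0 ?p0 ?r0//.
- by have /andP[] := pa k.+2 erefl.
- by have /andP[] := ra k.+2 erefl.
Qed.

Lemma chebTSS {D : nat} (A : nat -> 'M[R]_D) k :
  chebT A k.+2 = 2%:R *: (A k.+2 *m chebT A k.+1) - chebT A k.
Proof.
have chebT_pairE j : chebT_pair A j = (chebT A j, chebT A j.+1).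
  by rewrite /chebT /=; case: (chebT_pair A j).
by rewrite {1}/chebT /= chebT_pairE.
Qed.

Lemma sqfrob_chebT_le {D : nat} (A : nat -> 'M[R]_D) k :
  sqfrob (chebT A k) <=
  cheb_majorant (fun j => 4 * specnorm (A j) ^+ 2 + 2 * specnorm (A j))
    (fun j => 2 * specnorm (A j) + 1) D%:R k.
Proof.
set p := (X in cheb_majorant X); set r := (X in cheb_majorant _ X).
have a0 j : 0 <= specnorm (A j) by exact: specnorm_ge0.
suff : sqfrob (chebT A k) <= cheb_majorant p r D%:R k /\
  sqfrob (chebT A k.+1) <= cheb_majorant p r D%:R k.+1 by case.
elim: k => [|k [IH0 IH1]].
  split; first by rewrite /chebT/= sqfrob1.
  (* The first step has no predecessor term: D a^2 suffices, and a^2 is at most 4 a^2 + 2 a. *)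
  rewrite /chebT/= mulrC -[A 1%N]mulmx1.
  rewrite (le_trans (sqfrob_mulmx_le _ _))// sqfrob1 ler_wpM2r//.
  by rewrite /p; have := a0 1%N; have := sqr_ge0 (specnorm (A 1%N)); lra.
split=> //; rewrite chebTSS cheb_majorantSS.
rewrite (le_trans (sqfrob_chebyshev_step _ _ _))// lerD// mulrC ler_wpM2r//.
- by rewrite addr_ge0// mulr_ge0// sqr_ge0.
- by rewrite addr_ge0// mulr_ge0.
Qed.

End chebyshev_majorant.

(** * Mean of the random majorant *)

Section decoupled_majorant.
Context {d : measure_display} {T : measurableType d} {R : realType}.
Variables (P : probability T R) (F : option nat -> set (set T)).
Hypothesis F_measurable : forall o, F o `<=` measurable.
Hypothesis F_independent : mutually_independent P F.
Variables (p r : nat -> T -> R) (pbar rbar : nat -> R) (c : R).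
Hypothesis c0 : 0 <= c.
Hypothesis p0 : forall j x, (0 < j)%N -> 0 <= p j x.
Hypothesis r0 : forall j x, (0 < j)%N -> 0 <= r j x.
Hypothesis Fp : forall j B, measurable B -> F (Some j) (p j.+1 @^-1` B).
Hypothesis Fr : forall j B, measurable B -> F (Some j) (r j.+1 @^-1` B).
Hypothesis Ep : forall j, (0 < j)%N -> (\int[P]_x (p j x)%:E = (pbar j)%:E)%E.
Hypothesis Er : forall j, (0 < j)%N -> (\int[P]_x (r j x)%:E = (rbar j)%:E)%E.

Let u k x := cheb_majorant (p ^~ x) (r ^~ x) c k.
Let ubar k := cheb_majorant pbar rbar c k.
(** [Some j] stands for the matrix of index j + 1, so these are the first [k] matrices. [None], the
    class of the random index, is never included. *)
Let upto k : pred (option nat) := fun o => if o is Some j then (j < k)%N else false.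

Let mean_ge0 (f : nat -> T -> R) (fbar : nat -> R) j :
  (forall i x, (0 < i)%N -> 0 <= f i x) ->
  (forall i, (0 < i)%N -> (\int[P]_x (f i x)%:E = (fbar i)%:E)%E) ->
  (0 < j)%N -> 0 <= fbar j.
Proof.
by move=> f0 Ef j0; rewrite -lee_fin -Ef//; apply: integral_ge0 => x _; rewrite lee_fin f0.
Qed.

Let u_ge0 k x : 0 <= u k x.
Proof. by apply: cheb_majorant_ge0 => // j j0; [exact: p0|exact: r0]. Qed.

Let ubar_ge0 k : 0 <= ubar k.
Proof.
by apply: cheb_majorant_ge0 => // j; [exact: mean_ge0 p0 Ep|exact: mean_ge0 r0 Er].
Qed.

Let measurable_factor (f : nat -> T -> R) j :
  (forall i B, measurable B -> F (Some i) (f i.+1 @^-1` B)) ->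
  measurable_fun setT (f j.+1).
Proof. by move=> Ff _ B mB; rewrite setTI; exact: F_measurable (Ff _ _ mB). Qed.

Lemma measurable_cheb_majorant k : measurable_fun setT (u k).
Proof.
suff : measurable_fun setT (u k) /\ measurable_fun setT (u k.+1) by case.
elim: k => [|k [IH0 IH1]]; split; rewrite // /u /=.
- exact: measurable_cst.
- by apply: measurable_funM; [exact: measurable_cst|exact: measurable_factor].
- by apply: measurable_funD; apply: measurable_funM => //; exact: measurable_factor.
Qed.

(** The factor of index k + 1 belongs to class [Some k], outside [upto k]. Allowing m below k covers
    the term two steps back in the recursion. *)
Let decoupled_factor k m (f : nat -> T -> R) (fbar : nat -> R) (h : T -> R) (a : R) :
  (m <= k)%N -> 0 <= a -> (forall x, 0 <= h x) -> measurable_fun setT h ->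
  (forall i x, (0 < i)%N -> 0 <= f i x) ->
  (forall i B, measurable B -> F (Some i) (f i.+1 @^-1` B)) ->
  (forall i, (0 < i)%N -> (\int[P]_x (f i x)%:E = (fbar i)%:E)%E) ->
  decoupled P F (upto m) h a ->
  decoupled P F (upto k.+1) (fun x => h x * f k.+1 x) (a * fbar k.+1).
Proof.
move=> mk a0 h0 mh f0 Ff Ef Sh.
have Shk : decoupled P F (upto k) h a.
  by apply: decoupled_sub Sh => -[j|//] /= jm; exact: leq_trans mk.
have notk : ~~ upto k (Some k) by rewrite /= ltnn.
have := decoupledM P F F_measurable F_independent notk a0 h0 mh
  (fun x => f0 k.+1 x erefl) (Ff k) (Ef k.+1 erefl) Shk.
by apply: decoupled_sub => -[j|] /=; [case/predU1P => [[->]//|/ltnW]|].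
Qed.

Lemma decoupled_cheb_majorant k : decoupled P F (upto k) (u k) (ubar k).
Proof.
suff : decoupled P F (upto k) (u k) (ubar k) /\
  decoupled P F (upto k.+1) (u k.+1) (ubar k.+1) by case.
elim: k => [|k [IH0 IH1]]; split => //.
- exact: decoupled_cst.
- by apply: (decoupled_factor 0 0 p pbar) => //; exact: decoupled_cst.
have mu := measurable_cheb_majorant.
rewrite -[u k.+2]/(fun x => u k.+1 x * p k.+2 x + u k x * r k.+2 x).
rewrite -[ubar k.+2]/(ubar k.+1 * pbar k.+2 + ubar k * rbar k.+2).
apply: decoupledD => //.
- by move=> x; rewrite mulr_ge0 ?p0//; exact: u_ge0.
- by apply: measurable_funM; [exact: mu|exact: measurable_factor].
- by move=> x; rewrite mulr_ge0 ?r0//; exact: u_ge0.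
- by apply: measurable_funM; [exact: mu|exact: measurable_factor].
- by apply: (decoupled_factor k.+1 k.+1 p pbar).
- by apply: (decoupled_factor k.+1 k r rbar).
Qed.

End decoupled_majorant.

(** * Importance weights *)

Section von_mises_weights.
Context {R : realType}.
Variables lam kappa : R.
Hypothesis kappa0 : 0 <= kappa.

Let I0_gt0 : 0 < besselI 0%N kappa.
Proof. by rewrite (lt_le_trans ltr01)// besselI0_ge1. Qed.

Let abs_cos_le1 (x : R) : `|cos x| <= 1.
Proof. by rewrite ler_norml cos_geN1 cos_le1. Qed.

(** With cosines bounded by 1, the Bessel sum bound controls the partial sums and gives both
    convergence and the upper estimate. *)
Lemma ZVM_bounds : 1 <= ZVM lam kappa <= expR kappa / besselI 0%N kappa.
Proof.
set v := fun k => besselI k.+1 kappa * `|cos (k.+1%:R * acos lam)|.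
have v0 k : 0 <= v k by rewrite mulr_ge0// besselI_ge0.
have sv n : series v n <= (expR kappa - besselI 0%N kappa) / 2.
  rewrite ler_pdivlMr// lerBrDl mulrC.
  apply: le_trans (besselI_sum_le_expR kappa kappa0 n).
  rewrite lerD2l ler_wpM2l// /series/=; apply: ler_sum => k _.
  by rewrite /v ler_piMr// besselI_ge0.
have cv : cvgn (series v).
  apply: nondecreasing_is_cvgn; first by apply: nondecreasing_series => i _ _.
  by exists ((expR kappa - besselI 0%N kappa) / 2) => _ [n _ <-].
have lim0 : 0 <= limn (series v).
  by apply: limr_ge => //; apply: nearW => n; exact: sumr_ge0.
have lim_le : limn (series v) <= (expR kappa - besselI 0%N kappa) / 2.
  by apply: limr_le => //; exact: nearW.
rewrite /ZVM -/v; apply/andP; split.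
  by rewrite lerDl mulr_ge0// divr_ge0// ltW.
rewrite ler_pdivlMr// mulrDl mul1r mulrAC divfK ?gt_eqF//.
by rewrite -lerBrDl mulrC -ler_pdivlMr.
Qed.

Let Z_gt0 : 0 < ZVM lam kappa.
Proof. by have /andP[Z1 _] := ZVM_bounds; exact: lt_le_trans Z1. Qed.

Let Z_neq0 : ZVM lam kappa != 0. Proof. by rewrite gt_eqF. Qed.

Let I0_neq0 : besselI 0%N kappa != 0. Proof. by rewrite gt_eqF. Qed.

Let pi_neq0 : (pi : R) != 0. Proof. by rewrite gt_eqF// pi_gt0. Qed.

Lemma qVM_ge0 k : 0 <= qVM lam kappa k.
Proof.
rewrite /qVM; case: eqP => _; first by rewrite invr_ge0 ltW.
by rewrite mulr_ge0// mulr_ge0// divr_ge0 ?besselI_ge0// ltW.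
Qed.

(* When [q_k = 0], division by zero makes the left-hand side vanish. *)
Lemma importance_weight_le k :
  (gammaVM lam kappa k.+1 / qVM lam kappa k.+1) ^+ 2 * qVM lam kappa k.+1 <=
  2 * ZVM lam kappa / pi ^+ 2 * exp_coeff (kappa / 2) k.+1.
Proof.
set rhs := (X in _ <= X).
have rhs_ge0 : 0 <= rhs.
  rewrite mulr_ge0 ?exp_coeff_ge0 ?divr_ge0 ?sqr_ge0// mulr_ge0//.
  exact: ltW Z_gt0.
have [->|q0] := eqVneq (qVM lam kappa k.+1) 0; first by rewrite mulr0.
move: (q0); rewrite /gammaVM /qVM/=.
set I := besselI k.+1 kappa; set C := cos _ => q0'.
have I_neq0 : I != 0 by apply: contraNneq q0' => ->; rewrite mul0r mulr0 mul0r.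
have C_neq0 : `|C| != 0 by apply: contraNneq q0' => ->; rewrite mulr0.
(* The weight equals gamma^2 / q: one factor of the Bessel ratio and one of |cos| cancel. *)
rewrite (_ : _ * _ = 2 * ZVM lam kappa / pi ^+ 2 *
    (I / besselI 0%N kappa * `|C|)); last first.
  have C2 : C ^+ 2 = `|C| ^+ 2 by rewrite real_normK// num_real.
  rewrite expr_div_n exprMn C2.
  move: pi_neq0; generalize (@pi R) => q q_neq0; field.
  by rewrite C_neq0 I_neq0 I0_neq0 Z_neq0 q_neq0.
rewrite /rhs ler_wpM2l//; first by rewrite divr_ge0 ?sqr_ge0// mulr_ge0// ltW.
apply: (@le_trans _ _ (I / besselI 0%N kappa)).
  by rewrite ler_piMr ?abs_cos_le1// divr_ge0 ?besselI_ge0// ltW.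
by rewrite ler_pdivrMr//; exact: besselI_le.
Qed.

Lemma importance_weight0 :
  (gammaVM lam kappa 0%N / qVM lam kappa 0%N) ^+ 2 * qVM lam kappa 0%N =
  ZVM lam kappa / pi ^+ 2.
Proof.
rewrite /gammaVM /qVM /=; move: pi_neq0; generalize (@pi R) => q q_neq0; field.
by rewrite Z_neq0 q_neq0.
Qed.

(** The growth alpha^k merges with (kappa / 2)^k / k! into the exponential series at alpha kappa /
    2. The term k = 0 has its own weight and is split off. *)
Lemma importance_sum_le (c alpha : R) (b : nat -> R) n :
  0 <= c -> 0 <= alpha ->
  (forall k, 0 <= b k <= c * alpha ^+ k) ->
  \sum_(0 <= k < n) (gammaVM lam kappa k / qVM lam kappa k) ^+ 2
     * (b k * qVM lam kappa k) <=
  c * expR kappa / (pi ^+ 2 * besselI 0%N kappa)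
  * (1 + 2 * expR kappa / besselI 0%N kappa * (expR (alpha * kappa / 2) - 1)).
Proof.
move=> c0 a0 b_le.
pose w k := (gammaVM lam kappa k / qVM lam kappa k) ^+ 2 * (b k * qVM lam kappa k).
have w0 k : 0 <= w k.
  by rewrite /w mulr_ge0 ?sqr_ge0// mulr_ge0 ?qVM_ge0//; have /andP[] := b_le k.
apply: (@le_trans _ _ (\sum_(0 <= k < n.+1) w k)); first by rewrite big_nat_recr//= lerDl.
set y := alpha * kappa / 2.
have y0 : 0 <= y by rewrite divr_ge0// mulr_ge0.
have E1 : 1 <= expR y by rewrite -expR0 ler_expR.
have {w0} sum_le : \sum_(0 <= k < n.+1) w k <=
    c * (ZVM lam kappa / pi ^+ 2 * (1 + 2 * (expR y - 1))).
  rewrite big_nat_recl//=.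
  have -> : c * (ZVM lam kappa / pi ^+ 2 * (1 + 2 * (expR y - 1))) =
      c * (ZVM lam kappa / pi ^+ 2) +
      c * (2 * ZVM lam kappa / pi ^+ 2) * (expR y - 1) by ring.
  apply: lerD.
    rewrite /w [leLHS]mulrCA importance_weight0.
    rewrite ler_wpM2r ?divr_ge0 ?sqr_ge0 ?(ltW Z_gt0)//.
    by have /andP[_] := b_le 0%N; rewrite expr0 mulr1.
  apply: (@le_trans _ _ (c * (2 * ZVM lam kappa / pi ^+ 2) *
      \sum_(0 <= k < n) exp_coeff y k.+1)).
    rewrite mulr_sumr; apply: ler_sum => k _.
    rewrite /w [leLHS]mulrCA.
    apply: (@le_trans _ _ (c * alpha ^+ k.+1 *
        (2 * ZVM lam kappa / pi ^+ 2 * exp_coeff (kappa / 2) k.+1))).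
      apply: ler_pM => //; first by have /andP[] := b_le k.+1.
      - by rewrite mulr_ge0 ?sqr_ge0 ?qVM_ge0.
      - by have /andP[] := b_le k.+1.
      - exact: importance_weight_le.
    rewrite /y /exp_coeff/= -[alpha * kappa / 2]mulrA [X in _ <= _ * (X / _)]exprMn.
    by rewrite le_eqVlt; apply/orP; left; apply/eqP; ring.
  rewrite ler_wpM2l//.
    by rewrite mulr_ge0// divr_ge0 ?sqr_ge0// mulr_ge0// ltW.
  rewrite lerBrDl; apply: le_trans (series_exp_coeff_le_expR y n.+1 y0).
  by rewrite /series/= big_nat_recl//= /exp_coeff/= expr0 fact0 divr1.
apply: (le_trans sum_le).
have -> : c * expR kappa / (pi ^+ 2 * besselI 0%N kappa)
  * (1 + 2 * expR kappa / besselI 0%N kappa * (expR y - 1)) =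
  c * (expR kappa / besselI 0%N kappa / pi ^+ 2 *
    (1 + 2 * (expR kappa / besselI 0%N kappa) * (expR y - 1))).
  move: pi_neq0; generalize (@pi R) => q q_neq0; field.
  by rewrite I0_neq0 q_neq0.
have /andP[Z1 ZI] := ZVM_bounds.
(* The target replaces Z by its upper bound and carries this ratio once more before the exponential;
   being at least 1, it only enlarges the bound. *)
have I1 : 1 <= expR kappa / besselI 0%N kappa by exact: le_trans ZI.
rewrite ler_wpM2l// ler_pM//.
- by rewrite divr_ge0 ?sqr_ge0// ltW.
- by rewrite addr_ge0// mulr_ge0// subr_ge0.
- by rewrite ler_wpM2r// invr_ge0 sqr_ge0.
- rewrite lerD2l; apply: ler_wpM2r; first by rewrite subr_ge0.
  by rewrite ler_peMr.
Qed.

End von_mises_weights.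

(** * Splitting over the values of the random index *)

Section nat_valued.
Context {d : measure_display} {T : measurableType d} {R : realType}.
Local Open Scope ereal_scope.

Lemma integral_nat_valued_le (mu : {measure set T -> \bar R}) (K : T -> nat)
    (f : nat -> T -> \bar R) (g : nat -> T -> R) :
  (forall k, measurable (K @^-1` [set k])) ->
  (forall k, measurable_fun setT (g k)) ->
  (forall k x, 0 <= f k x) -> (forall k x, f k x <= (g k x)%:E) ->
  \int[mu]_x f (K x) x <=
  \sum_(k <oo) \int[mu]_(x in K @^-1` [set k]) (g k x)%:E.
Proof.
move=> mK mg f0 fg.
have g0 k x : 0 <= (g k x)%:E by exact: le_trans (fg k x).
under eq_eseriesr do rewrite integral_mkcond.
rewrite -integral_nneseries//; last 2 first.
- move=> k; apply/(measurable_restrictT _ _).1 => //.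
  by apply/measurable_EFinP; exact: measurable_funTS.
- by move=> k x _; apply: erestrict_ge0.
apply: ge0_le_integralT => // x; apply: (le_trans (fg _ _)).
(* At a point x the term of index [K x] already dominates; the others are nonnegative. *)
rewrite (@nneseriesD1 _ _ (K x))//; last by move=> k _; apply: erestrict_ge0.
rewrite patchE mem_set//= leeDl//; apply: nneseries_ge0 => k _ _.
exact: erestrict_ge0.
Qed.

End nat_valued.

(** The moments are a priori extended reals; the finite bound [alpha] rules out infinity, so they
    can be named as reals. *)
Lemma specnorm_moments {d : measure_display} {T : measurableType d}
    {R : realType} (P : probability T R) {D : nat} (X : T -> 'M[R]_D)
    (alpha : R) (a := fun x => specnorm (X x)) :
  (forall i j, measurable_fun setT (fun x => X x i j)) ->
  (4%:E * \int[P]_x (a x ^+ 2)%:E + 2%:E * \int[P]_x (a x)%:E + 1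
     <= alpha%:E)%E ->
  exists m1 m2 : R, [/\ 0 <= m1, 0 <= m2, 4 * m2 + 2 * m1 + 1 <= alpha,
    (\int[P]_x (4 * a x ^+ 2 + 2 * a x)%:E = (4 * m2 + 2 * m1)%:E)%E &
    (\int[P]_x (2 * a x + 1)%:E = (2 * m1 + 1)%:E)%E].
Proof.
move=> mX; have a0 x : 0 <= a x by exact: specnorm_ge0.
have ma : measurable_fun setT a by exact: measurable_specnorm.
have mEa : measurable_fun setT (fun x => (a x)%:E) by exact/measurable_EFinP.
have mEa2 : measurable_fun setT (fun x => (a x ^+ 2)%:E).
  by apply/measurable_EFinP; exact: measurable_funX.
have -> : (\int[P]_x (4 * a x ^+ 2 + 2 * a x)%:E =
    4%:E * \int[P]_x (a x ^+ 2)%:E + 2%:E * \int[P]_x (a x)%:E)%E.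
  under eq_integral do rewrite EFinD !EFinM.
  rewrite ge0_integralD//; last 4 first.
  - by move=> x _; rewrite -EFinM lee_fin mulr_ge0// sqr_ge0.
  - exact: measurable_funeM.
  - by move=> x _; rewrite -EFinM lee_fin mulr_ge0.
  - exact: measurable_funeM.
  rewrite !ge0_integralZl ?lee_fin//.
  - by move=> x _; rewrite lee_fin.
  - by move=> x _; rewrite lee_fin sqr_ge0.
have -> : (\int[P]_x (2 * a x + 1)%:E = 2%:E * \int[P]_x (a x)%:E + 1)%E.
  under eq_integral do rewrite EFinD EFinM.
  rewrite ge0_integralD//; last 2 first.
  - by move=> x _; rewrite -EFinM lee_fin mulr_ge0.
  - exact: measurable_funeM.
  rewrite ge0_integralZl ?lee_fin//; last by move=> x _; rewrite lee_fin.
  rewrite integral_cst//; congr (_ + _)%E; rewrite mul1e; exact: probability_setT.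
have : (0 <= \int[P]_x (a x)%:E)%E by apply: integral_ge0 => x _; rewrite lee_fin.
have : (0 <= \int[P]_x (a x ^+ 2)%:E)%E.
  by apply: integral_ge0 => x _; rewrite lee_fin sqr_ge0.
case: (\int[P]_x (a x ^+ 2)%:E)%E => [m2| |]//; last first.
  case: (\int[P]_x (a x)%:E)%E => [m1| |]// _ _.
  - by rewrite gt0_muley ?lte_fin// addye// addye// leye_eq.
  - by rewrite !gt0_muley ?lte_fin// addye// addye// leye_eq.
case: (\int[P]_x (a x)%:E)%E => [m1| |]//; rewrite !lee_fin; last first.
  by rewrite gt0_muley ?lte_fin// addey// addye// leye_eq.
by move=> m20 m10 le_alpha; exists m1, m2; split.
Qed.

(** * Assembly of the second-moment bound *)

Theorem mainTheorem7 (d : measure_display) (T : measurableType d)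
  (R : realType) (P : probability T R) (D : nat) (A : 'M[R]_D)
  (Ah : nat -> T -> 'M[R]_D) (K : T -> nat) (alpha lam kappa : R) :
  (* A is real symmetric *)
  A^T = A ->
  (* each Ah_j (j >= 1) is a random matrix: measurable entries *)
  (forall j : nat, (0 < j)%N -> forall i l : 'I_D,
     measurable_fun setT (fun x => Ah j x i l)) ->
  (* E[Ah_j] = A (entrywise, entries integrable) *)
  (forall j : nat, (0 < j)%N -> forall i l : 'I_D,
     P.-integrable setT (fun x => (Ah j x i l)%:E) /\
     (\int[P]_x (Ah j x i l)%:E = (A i l)%:E)%E) ->
  (* 4 E[||Ah_k||^2] + 2 E[||Ah_k||] + 1 <= alpha *)
  (forall k : nat, (0 < k)%N ->
     (4%:E * \int[P]_x ((specnorm (Ah k x)) ^+ 2)%:E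
      + 2%:E * \int[P]_x (specnorm (Ah k x))%:E + 1 <= alpha%:E)%E) ->
  -1 < lam < 1 -> 0 < kappa ->
  (* K is a nat-valued random variable with law q(lam, kappa) *)
  (forall k : nat, measurable (K @^-1` [set k])) ->
  (forall k : nat, P (K @^-1` [set k]) = (qVM lam kappa k)%:E) ->
  (* K, Ah_1, Ah_2, ... are mutually independent *)
  mutually_independent P
    (fun o : option nat => match o with
                           | None => sigma_nat K
                           | Some j => sigma_mx (Ah j.+1)
                           end) ->
  (\int[P]_x ((frobnorm ((gammaVM lam kappa (K x) / qVM lam kappa (K x))
                          *: chebT (fun j => Ah j x) (K x))) ^+ 2)%:E
   <= (D%:R * expR kappa / (pi ^+ 2 * besselI 0 kappa)
       * (1 + 2 * expR kappa / besselI 0 kappa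
              * (expR (alpha * kappa / 2) - 1)))%:E)%E.
Proof.
move=> _ mAh _ alpha_bound _ kappa_gt0 mK lawK indep.
have kappa0 : 0 <= kappa by exact: ltW.
set F := (X in mutually_independent P X) in indep.
have F_measurable o : F o `<=` measurable.
  case: o => [j|]; first by apply: sigma_mx_measurable => i l; exact: mAh.
  move=> _ [B _ <-]; rewrite (_ : _ @^-1` _ = \bigcup_(k in B) K @^-1` [set k]).
    by apply: bigcup_measurable => k _; exact: mK.
  by apply/seteqP; split=> [x BK|x [k Bk /= ->]//]; exists (K x).
pose a j x := specnorm (Ah j x).
have a0 j x : 0 <= a j x by exact: specnorm_ge0.
pose p j x := 4 * a j x ^+ 2 + 2 * a j x; pose r j x := 2 * a j x + 1.
(* The pair holds the first and second moments of the spectral norm; index 0 gets a dummy value. *)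
have /choice[m hm] : forall j, exists m : R * R, (0 < j)%N ->
    [/\ 0 <= m.1, 0 <= m.2, 4 * m.2 + 2 * m.1 + 1 <= alpha,
      (\int[P]_x (p j x)%:E = (4 * m.2 + 2 * m.1)%:E)%E &
      (\int[P]_x (r j x)%:E = (2 * m.1 + 1)%:E)%E].
  move=> [|j]; first by exists (0, 0).
  have [m1 [m2 hm]] := specnorm_moments P (Ah j.+1) alpha (mAh j.+1 erefl)
    (alpha_bound j.+1 erefl).
  by exists (m1, m2).
pose pbar j := 4 * (m j).2 + 2 * (m j).1; pose rbar j := 2 * (m j).1 + 1.
have p0 j x : (0 < j)%N -> 0 <= p j x.
  by move=> _; rewrite addr_ge0// mulr_ge0// sqr_ge0.
have r0 j x : (0 < j)%N -> 0 <= r j x by move=> _; rewrite addr_ge0// mulr_ge0.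
have Fp j B : measurable B -> F (Some j) (p j.+1 @^-1` B).
  move=> mB; apply: (sigma_mx_preimage_specnorm _ (fun y => 4 * y ^+ 2 + 2 * y)) => //.
  by apply: measurable_funD; apply: measurable_funM => //; exact: measurable_funX.
have Fr j B : measurable B -> F (Some j) (r j.+1 @^-1` B).
  move=> mB; apply: (sigma_mx_preimage_specnorm _ (fun y => 2 * y + 1)) => //.
  by apply: measurable_funD => //; apply: measurable_funM.
have Ep j : (0 < j)%N -> (\int[P]_x (p j x)%:E = (pbar j)%:E)%E by case/hm.
have Er j : (0 < j)%N -> (\int[P]_x (r j x)%:E = (rbar j)%:E)%E by case/hm.
pose u k x := cheb_majorant (p ^~ x) (r ^~ x) D%:R k.
pose ubar k := cheb_majorant pbar rbar D%:R k.
have mu k : measurable_fun setT (u k).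
  exact: (measurable_cheb_majorant F F_measurable p r D%:R Fp Fr).
have u0 k x : 0 <= u k x by apply: cheb_majorant_ge0 => // j; [exact: p0|exact: r0].
(* The majorant involves only the matrices, so decoupling on the single event K = k factors out the
   probability q_k. *)
have mean_u k : (\int[P]_(x in K @^-1` [set k]) (u k x)%:E =
    (ubar k * qVM lam kappa k)%:E)%E.
  have := decoupled_cheb_majorant P F F_measurable indep p r pbar rbar D%:R
    (ler0n _ _) p0 r0 Fp Fr Ep Er k [:: None] (fun=> K @^-1` [set k]) erefl.
  rewrite !big_seq1 EFinM lawK; apply => o; rewrite inE => /eqP ->.
  by split => //; exists [set k].
have ubar0 k : 0 <= ubar k * qVM lam kappa k.
  by rewrite -lee_fin -mean_u; apply: integral_ge0 => x _; rewrite lee_fin.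
have ubar_bounds k : 0 <= ubar k <= D%:R * alpha ^+ k.
  have alpha_ge1 : 1 <= alpha by have [] := hm 1%N erefl; lra.
  have bar_ge0 j : (0 < j)%N -> 0 <= pbar j /\ 0 <= rbar j.
    by case/hm => m1 m2 _ _ _; rewrite /pbar /rbar; split; lra.
  apply/andP; split.
    by apply: cheb_majorant_ge0 => // j /bar_ge0[].
  apply: cheb_majorant_le => // j j0; have [pj rj] := bar_ge0 j j0.
    by have [m1 m2 le_alpha _ _] := hm j j0; rewrite pj/= /pbar; lra.
  by have [m1 m2 le_alpha _ _] := hm j j0; rewrite rj/= /rbar; lra.
pose w k := (gammaVM lam kappa k / qVM lam kappa k) ^+ 2.
have w0 k : 0 <= w k by exact: sqr_ge0.
apply: (@le_trans _ _
    (\sum_(k <oo) \int[P]_(x in K @^-1` [set k]) (w k * u k x)%:E)%E).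
  apply: (integral_nat_valued_le P K (fun k x => (frobnorm
    ((gammaVM lam kappa k / qVM lam kappa k) *: chebT (fun j => Ah j x) k) ^+ 2)%:E)) => //.
  - by move=> k; apply: measurable_funM.
  - by move=> k x; rewrite lee_fin sqr_ge0.
  - move=> k x; rewrite lee_fin frobnorm_sqr sqfrobZ ler_wpM2l//.
      exact: sqr_ge0.
    exact: sqfrob_chebT_le.
rewrite (eq_eseriesr (g := fun k => (w k * (ubar k * qVM lam kappa k))%:E)); last first.
  move=> k _; under eq_integral do rewrite EFinM.
  rewrite ge0_integralZl ?lee_fin//.
  - by rewrite mean_u.
  - by apply/measurable_EFinP; exact: measurable_funTS.
  - by move=> x _; rewrite lee_fin.
(* It suffices to bound every partial sum of the series by the same constant. *)
apply: lime_le.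
  by apply: is_cvg_nneseries => k _ _; rewrite lee_fin mulr_ge0.
apply: nearW => n; rewrite sumEFin lee_fin.
apply: importance_sum_le => //.
by have [] := hm 1%N erefl; lra.
Qed.
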